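(* Let $k\ge 3$ be an integer such that both $k$ and $k-1$ are prime powers, and suppose that there exists a resolvable Steiner system $\mathrm{S}(2,k,n)$. Then for each integer $i$ with $0\le i\le \frac{n-1}{k-1}$ there exists an $\mathrm{MS}(2,k,\mathbb{Z}_2^{(k-1)n}\times\mathbb{Z}_{n+1-(k-1)i})$.
   Context: A Steiner system $\mathrm{S}(t,k,n)$ on an $n$-set is a collection of $k$-subsets (blocks) of the $n$-set such that each $t$-subset is contained in exactly one block. An $\mathrm{S}(2,k,n)$ is resolvable if its blocks can be partitioned into $\frac{n-1}{k-1}$ parallel classes, where a parallel class is a set of blocks such that each point is contained in exactly one block of the set (i.e., an $\mathrm{S}(1,k,n)$). A mixed Steiner system $\mathrm{MS}(t,k,Q)$ over a mixed alphabet $Q=\mathbb{Z}_{q_1}\times\cdots\times\mathbb{Z}_{q_N}$ (with $q_i\ge 2$) is a set $\mathcal{C}$ of words of $Q$ of weight $k$ (weight = number of nonzero coordinates) such that (i) for each word $x\in Q$ of weight $t$ there is exactly one $c\in\mathcal{C}$ with $d(x,c)=k-t$ ($c$ covers $x$), where $d$ is the Hamming distance, and (ii) any two distinct codewords of $\mathcal{C}$ are at Hamming distance at least $2(k-t)+1$. *)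

(* Defs.v *)
From mathcomp Require Import all_boot all_order all_algebra.
Set Implicit Arguments.
Unset Strict Implicit.
Unset Printing Implicit Defensive.

Definition prime_power (m : nat) : Prop :=
  exists p e : nat, [/\ prime p, 0 < e & m = p ^ e].

Definition steiner_system (T : finType) (t k : nat) (B : {set {set T}}) : Prop :=
  (forall b, b \in B -> #|b| = k) /\
  (forall X : {set T}, #|X| = t -> exists! b, b \in B /\ X \subset b).

Definition parallel_class (T : finType) (D : {set {set T}}) : Prop :=
  forall x : T, exists! b, b \in D /\ x \in b.

(* The equation on #|P| says that #|P| is exactly (#|T| - 1) / (k - 1), with no
   truncation of either operation; in particular it forces #|T| > 0. *)
Definition resolvable_steiner2 (T : finType) (k : nat) (B : {set {set T}}) : Prop :=
  steiner_system 2 k B /\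
  exists P : {set {set {set T}}},
    [/\ partition P B,
        (#|P| * (k - 1)).+1 = #|T| &
        forall D, D \in P -> parallel_class D].

(* The alphabet Z_{q_1} x ... x Z_{q_N} is given by the list q = [:: q_1; ...; q_N].
   'Z_m is the ring of integers mod m only for m >= 2, which [mixed_steiner]
   imposes on all entries of q. *)
Definition word (q : seq nat) : finType :=
  {dffun forall j : 'I_(size q), 'Z_(nth 2 q j)}.

Definition weight (q : seq nat) (x : word q) : nat :=
  #|[set j : 'I_(size q) | x j != 0%R]|.

Definition hdist (q : seq nat) (x y : word q) : nat :=
  #|[set j : 'I_(size q) | x j != y j]|.

(* Meant for t <= k, so that k - t is not truncated. *)
Definition mixed_steiner (t k : nat) (q : seq nat) (C : {set word q}) : Prop :=
  [/\ forall m, m \in q -> 2 <= m,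
      forall c, c \in C -> weight c = k,
      forall x : word q, weight x = t -> exists! c, c \in C /\ hdist x c = k - t &
      forall c c', c \in C -> c' \in C -> c != c' -> 2 * (k - t) + 1 <= hdist c c'].

(* Main.v *)
Require Import Defs.
From mathcomp Require Import all_boot all_order all_fingroup all_algebra.
From mathcomp Require Import all_field zify ring.
Set Implicit Arguments.
Unset Strict Implicit.
Unset Printing Implicit Defensive.

(** Let [N = (k-1)n] and let [m] be the size of the last alphabet.  A word is
    a subset of the [N] binary points together with an optional label, one of
    the [m-1] nonzero letters of the last coordinate.  Under this reading an
    MS(2,k) is a family of unlabelled [k]-subsets and labelled
    [(k-1)]-subsets such that every pair of points lies in exactly one block
    and the blocks carrying a given label partition the points
    ([mixed_steiner_of_design]): a weight-2 word is either a pair of points or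
    a point with a label, and two codewords at small distance would share a
    pair of points, or a point and a label.

    To build such a design take the points to be [T * F], where [T] carries
    the resolvable S(2,k,n) and [F] is the field of order [k-1].  The fibres
    [{x} * F] are [(k-1)]-sets partitioning the points, so they get a common
    label and cover all pairs inside a fibre.  Two points of different fibres
    [x], [y] must be covered by a block above the unique block [b] of the
    Steiner system through [x] and [y], and there are two ways to fill [b * F]:

    - with a transversal design over [F], the [k = |F|+1] fibres being indexed
      by the projective line [option F]; all blocks are unlabelled
      ([transversal_local_design]);
    - with the affine plane over the field [K] of order [k] minus a line: [b] is
      identified with [K] and [F] with the nonzero elements of [K].  The lines
      parallel to the deleted one are [k]-sets, left unlabelled, and each of
      the [k-1] other slopes (other than that of the fibres) gives a partition
      of [b * F] into [(k-1)]-sets, labelled by that slope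
      ([affine_local_design]).

    The second filling contributes labels that cover only [b * F], but
    when it is used for all the blocks of a parallel class the labels cover
    all points.  Using it on [s] of the [r = (n-1)/(k-1)] parallel classes thus
    gives [1 + s(k-1)] labels ([labelled_design_of_local]), and [s = r - i]
    makes this number [m - 1]. *)

(** * Words as labelled sets *)

Lemma pointed_bijection (A B : finType) (a : A) (b : B) :
  #|A| = #|B| -> exists2 f : A -> B, bijective f & f a = b.
Proof.
move=> eqAB.
pose h x := enum_val (cast_ord eqAB (enum_rank x)).
exists (fun x => tperm (h a) b (h x)); last by rewrite tpermL.
apply: inj_card_bij; last by rewrite eqAB.
by move=> x y /perm_inj/enum_val_inj/cast_ord_inj/enum_rank_inj.
Qed.

Lemma card_option_pred (V : finType) (P : pred (option V)) :
  #|[set o | P o]| = #|[set v | P (Some v)]| + P None.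
Proof.
rewrite (cardsD1 None) inE addnC -[in RHS](card_imset _ (@Some_inj _)).
congr (_ + _).
apply: eq_card => -[v|]; rewrite !inE /=; last by apply/esym/imsetP => -[].
by rewrite mem_imset ?inE //; apply: Some_inj.
Qed.

Lemma hdist_eq0 (q : seq nat) (x y : word q) : hdist x y = 0 -> x = y.
Proof.
move=> /eqP; rewrite cards_eq0 => /eqP d0; apply/ffunP => j.
by have := in_set0 j; rewrite -d0 inE => /negbFE/eqP.
Qed.

Lemma card_symdiff (V : finType) (A B : {set V}) :
  #|[set v | (v \in A) != (v \in B)]| + 2 * #|A :&: B| = #|A| + #|B|.
Proof.
have -> : [set v | (v \in A) != (v \in B)] = (A :\: B) :|: (B :\: A).
  by apply/setP => v; rewrite !inE; case: (v \in A); case: (v \in B).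
rewrite cardsU (_ : _ :&: _ = set0) ?cards0 ?subn0; last first.
  by apply/setP => v; rewrite !inE; case: (v \in A); case: (v \in B).
by rewrite -(cardsID B A) -(cardsID A B) [B :&: A]setIC; lia.
Qed.

(** Adding twice the size of the intersection of the supports keeps the
    distance formula free of truncated subtraction. *)
Lemma word_codec (V L : finType) N m : #|V| = N -> #|L|.+1 = m -> 2 <= m ->
  let q := rcons (nseq N 2) m in
  exists (supp : word q -> {set V}) (lab : word q -> option L),
  [/\ forall A l, exists x, supp x = A /\ lab x = l,
      forall x, weight x = #|supp x| + (lab x != None) &
      forall x y, hdist x y + 2 * #|supp x :&: supp y|
                    = #|supp x| + #|supp y| + (lab x != lab y)].
Proof.
move=> cardV cardL m_ge2 q.
have szq : size q = N.+1 by rewrite size_rcons size_nseq.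
pose lst : 'I_(size q) := cast_ord (esym szq) ord_max.
have [|idx idx_bij idxN] := @pointed_bijection (option V) 'I_(size q) None lst.
  by rewrite card_option cardV card_ord szq.
(* [idx] names the last coordinate [None] and the binary ones [Some v]. *)
have modN : nth 2 q (idx None) = m.
  by rewrite idxN nth_rcons size_nseq /= ltnn eqxx.
have modS v : nth 2 q (idx (Some v)) = 2.
  rewrite nth_rcons size_nseq nth_nseq if_same.
  have ltN : idx (Some v) < N.+1 by rewrite -szq.
  have neN : (idx (Some v) : nat) != N.
    apply/eqP => eqN; suff /(bij_inj idx_bij) : idx (Some v) = idx None by [].
    by rewrite idxN; apply/val_inj.
  by case: ltnP => // geN; case: eqP neN => //; lia.
have truncS v : (Zp_trunc (nth 2 q (idx (Some v)))).+2 = 2 by rewrite modS.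
have truncN : (Zp_trunc (nth 2 q (idx None))).+2 = m.
  by rewrite modN /Zp_trunc; lia.
have [|lb lb_bij lb0] := @pointed_bijection
    'I_(Zp_trunc (nth 2 q (idx None))).+2 (option L) ord0 None.
  by rewrite card_ord card_option truncN cardL.
have [idx' idxK idxK'] := idx_bij; have [lb' lbK lbK'] := lb_bij.
pose supp (x : word q) := [set v | x (idx (Some v)) != 0%R].
pose lab (x : word q) := lb (x (idx None)).
have labE (x y : word q) : (lab x != lab y) = (x (idx None) != y (idx None)).
  by rewrite /lab (inj_eq (bij_inj lb_bij)).
have lab0 (x : word q) : (lab x != None) = (x (idx None) != 0%R).
  by rewrite /lab -lb0 (inj_eq (bij_inj lb_bij)).
have suppE (x y : word q) v : (x (idx (Some v)) != y (idx (Some v)))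
    = ((v \in supp x) != (v \in supp y)).
  have bit (z : word q) : (z (idx (Some v)) : nat) = (v \in supp z).
    rewrite inE -val_eqE /=; have := ltn_ord (z (idx (Some v))).
    by rewrite {2}truncS; case: (nat_of_ord _) => [|[|]].
  by rewrite -val_eqE /= !bit; do 2!case: (_ \in _).
exists supp, lab; split => [A l|x|x y].
- pose bitA o := if o is Some v then (v \in A : nat) else lb' l : nat.
  exists [ffun j => inZp (bitA (idx' j))]; split.
    apply/setP => v; rewrite !inE ffunE idxK -val_eqE /= truncS.
    by case: (v \in A).
  rewrite /lab ffunE idxK /= -[RHS]lbK'; congr lb; apply/val_inj => /=.
  by rewrite modn_small.
- rewrite /weight -(on_card_preimset (onW_bij _ idx_bij)).
  rewrite lab0 -(card_option_pred (fun o => x (idx o) != 0%R)).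
  by apply: eq_card => o; rewrite !inE.
- rewrite -card_symdiff addnAC; congr (_ + _).
  rewrite /hdist -(on_card_preimset (onW_bij _ idx_bij)) labE.
  have -> : [set v | (v \in supp x) != (v \in supp y)]
      = [set v | x (idx (Some v)) != y (idx (Some v))].
    by apply/setP => v; rewrite inE [RHS]inE suppE.
  rewrite -(card_option_pred (fun o => x (idx o) != y (idx o))).
  by apply: eq_card => o; rewrite !inE.
Qed.

(** * Mixed Steiner systems from labelled designs *)

Definition labelled_design (V L : finType) (k : nat)
    (S : {set {set V} * option L}) : Prop :=
  [/\ forall p, p \in S -> #|p.1| + (p.2 != None) = k,
      forall u v, u != v -> exists! p, [/\ p \in S, u \in p.1 & v \in p.1] &
      forall u l, exists! A : {set V}, (A, Some l) \in S /\ u \in A].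

(** Let [t] be the size of the intersection of the supports.  A word of weight 2
    is at distance [k - 2] from a codeword exactly when [t = 2], if the word is
    a pair, and when [t = 1] and the labels agree, if it is a labelled point.
    Two distinct codewords have [t <= 1], and [t = 0] if they share a label;
    the least distance [2k - 3] is reached by two blocks with different
    labels that meet. *)
Lemma mixed_steiner_of_design (V L : finType) k N m
    (S : {set {set V} * option L}) :
  #|V| = N -> #|L|.+1 = m -> 2 <= m -> 3 <= k -> labelled_design k S ->
  exists C : {set word (rcons (nseq N 2) m)}, mixed_steiner 2 k C.
Proof.
move=> cardV cardL m_ge2 k_ge3 [Ssize Spair Slab].
have [supp [lab [codeP weightE hdistE]]] := word_codec cardV cardL m_ge2.
have code_inj x y : supp x = supp y -> lab x = lab y -> x = y.
  move=> eqs eql; apply: hdist_eq0; have := hdistE x y.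
  by rewrite eqs eql eqxx setIid; lia.
exists [set x | (supp x, lab x) \in S].
split=> [j|c|x wx|c c'].
- by rewrite mem_rcons inE => /orP[/eqP->//|/nseqP[->]].
- by rewrite inE weightE => /Ssize.
- have := wx; rewrite weightE; case labx: (lab x) => [a|] /=.
    rewrite addn1 => -[] /eqP/cards1P[u suppx].
    have [A [[SA uA] uniqA]] := Slab u a.
    have [c [suppc labc]] := codeP A (Some a).
    exists c; split.
      rewrite inE suppc labc SA; split=> //.
      have := hdistE x c; have := Ssize _ SA.
      rewrite suppx suppc labx labc eqxx cards1 /=.
      by rewrite (setIidPl _) ?sub1set // cards1; lia.
    move=> c'; rewrite inE => -[Sc' dc'].
    have := hdistE x c'; have := Ssize _ Sc'.
    rewrite dc' suppx labx cards1 /=.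
    have uc' : #|[set u] :&: supp c'| = (u \in supp c').
      case uc': (u \in supp c'); first by rewrite (setIidPl _) ?sub1set ?cards1.
      apply/eqP; rewrite cards_eq0; apply/eqP/setP => v; rewrite !inE.
      by case: eqP => // ->; rewrite uc'.
    rewrite uc'; case: (boolP (u \in _)) => uc''; last first.
      by case: (lab c') => [b|] /=; last lia; case: (_ != _); lia.
    case labc': (lab c') => [b|] /=; last lia.
    case: eqVneq => [eqab|_] /=; last by lia.
    move=> _ _; apply: code_inj; last by rewrite labc labc' eqab.
    by rewrite suppc; apply: uniqA; rewrite [Some a]eqab -labc'.
  rewrite addn0 => /eqP/cards2P[u [v [neuv suppx]]].
  have c2 : #|[set u; v]| = 2 by rewrite cards2 neuv.
  have [[A l] [[SA uA vA] uniqA]] := Spair u v neuv.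
  have [c [suppc labc]] := codeP A l.
  have subA (B : {set V}) : ([set u; v] \subset B) = (u \in B) && (v \in B).
    by rewrite subUset !sub1set.
  exists c; split.
    rewrite inE suppc labc SA; split=> //.
    have := hdistE x c; have := Ssize _ SA.
    rewrite suppx suppc labx labc c2 (setIidPl _) ?subA ?uA ?vA //= c2.
    by case: (l) => [a|] /=; lia.
  move=> c'; rewrite inE => -[Sc' dc'].
  have := hdistE x c'; have := Ssize _ Sc'.
  rewrite dc' suppx labx c2 /= => sizec' dcap.
  have e3 : #|[set u; v] :&: supp c'| = #|[set u; v]|.
    by rewrite c2; move: sizec' dcap; case: (lab c') => [a|] /=; lia.
  have /setIidPl : [set u; v] :&: supp c' = [set u; v].
    by apply/eqP; rewrite eqEcard subsetIl e3 leqnn.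
  rewrite subA => /andP[uc vc].
  have [] : (A, l) = (supp c', lab c') by apply: uniqA.
  by rewrite -suppc -labc; apply: code_inj.
- rewrite !inE => Sc Sc' necc'.
  have le1 : #|supp c :&: supp c'| <= 1.
    rewrite leqNgt; apply/negP => /card_gt1P[u [v []]].
    rewrite !inE => /andP[uc uc'] /andP[vc vc'] neuv.
    have [p [_ uniqp]] := Spair u v neuv.
    have : (supp c, lab c) = (supp c', lab c').
      by rewrite -(uniqp (supp c, lab c)) // -(uniqp (supp c', lab c')).
    by case=> ? ?; case/eqP: necc'; apply: code_inj.
  have same a : lab c = Some a -> lab c' = Some a -> #|supp c :&: supp c'| = 0.
    move=> labc labc'; apply/eqP; rewrite cards_eq0; apply/set0Pn => -[u].
    rewrite inE => /andP[uc uc'].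
    have [A [_ uniqA]] := Slab u a.
    case/eqP: necc'; apply: code_inj; last by rewrite labc.
    by rewrite -(uniqA (supp c)) -?labc // -(uniqA (supp c')) // -?labc'.
  have := hdistE c c'; have := Ssize _ Sc; have := Ssize _ Sc'; move: le1 same.
  case: (lab c) => [a|]; case: (lab c') => [b|] /= le1 same; try lia.
  case: eqVneq => [eqab|_] /=; last by lia.
  by have := same a erefl (esym eqab); lia.
Qed.

(** * Filling the fibres above one block *)

Definition graph (T F : finType) (b : {set T}) (f : T -> option F) :=
  [set v : T * F | (v.1 \in b) && (f v.1 == Some v.2)].

Lemma graphP (T F : finType) (b : {set T}) (f : T -> option F) x g :
  reflect (x \in b /\ f x = Some g) ((x, g) \in graph b f).
Proof. by rewrite inE; apply: (iffP andP) => -[? /eqP]. Qed.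

Lemma card_graph (T F : finType) (b : {set T}) (f : T -> option F) :
  #|graph b f| = #|[set x in b | f x != None]|.
Proof.
rewrite -(@card_in_imset _ _ fst (graph b f)); last first.
  move=> [x g] [y h] /graphP[_ fx] /graphP[_ fy] /= eqxy.
  by move: fx; rewrite eqxy fy => -[->].
apply: eq_card => x; rewrite inE; apply/imsetP/andP.
  by case=> -[y g] /graphP[yb fy] /= ->; rewrite fy.
by case=> xb; case fx: (f x) => [g|] // _; exists (x, g) => //; apply/graphP.
Qed.

(** The blocks used above [b] are graphs of partial functions, hence meet every
    fibre at most once: pairs inside a fibre are left to the fibre itself. *)
Definition local_design (T F : finType) (k : nat) (b : {set T})
    (labelled : bool) (S : {set {set T * F} * option F}) : Prop :=
  [/\ forall p, p \in S -> #|p.1| + (p.2 != None) = k,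
      forall p, p \in S -> exists f, p.1 = graph b f,
      forall u v, u.1 \in b -> v.1 \in b -> u.1 != v.1 ->
        exists! p, [/\ p \in S, u \in p.1 & v \in p.1] &
      if labelled
      then forall u l, u.1 \in b -> exists! A, (A, Some l) \in S /\ u \in A
      else forall p, p \in S -> p.2 = None].

(** The counting clause is how surjectivity of the coordinate [c : b -> K] is
    used: sizes of graphs above [b] are computed in [K]. *)
Lemma coordinates (T K : finType) (b : {set T}) (k0 : K) : #|b| = #|K| ->
  exists c : T -> K, {in b &, injective c} /\
    forall P : pred K, #|[set x in b | P (c x)]| = #|P|.
Proof.
move=> eqbK.
have [x0 x0b] : exists x0, x0 \in b.
  by apply/set0Pn; rewrite -card_gt0 eqbK; apply/card_gt0P; exists k0.
have [|f f_bij _] := @pointed_bijection {x | x \in b} K (Sub x0 x0b) k0.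
  by rewrite card_sig.
have [f' fK fK'] := f_bij.
pose c x := oapp f k0 (insub x : option {x | x \in b}).
have cE (u : {x | x \in b}) : c (val u) = f u by rewrite /c valK.
have c_inj : {in b &, injective c}.
  move=> x y xb yb; have := cE (Sub x xb); have := cE (Sub y yb).
  by rewrite !SubK => -> -> /(bij_inj f_bij)/(congr1 val); rewrite !SubK.
exists c; split=> // P.
rewrite -(@card_in_imset _ _ c) => [|x y]; last first.
  by rewrite !inE => /andP[xb _] /andP[yb _]; apply: c_inj.
apply: eq_card => z; apply/imsetP/idP => [[x]|Pz].
  by rewrite inE => /andP[_ Px] ->.
exists (val (f' z)); last by rewrite cE fK'.
by rewrite inE (valP (f' z)) cE fK'.
Qed.

Section FieldConstructions.
Import GRing.Theory.
Local Open Scope ring_scope.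

(** The bijection [psi] plays two roles.  On ordinates it identifies [F] with
    the nonzero elements of [K] and makes a line undefined where it meets the
    deleted line of ordinate 0, so that a line of nonzero slope loses one point.
    On slopes it makes the lines of slope 0 unlabelled and labels the others.
    The pair (slope, intercept) equal to (0, 0) is the deleted line. *)
Lemma affine_local_design (T F : finType) (K : finFieldType)
    (psi : K -> option F) (b : {set T}) :
  bijective psi -> psi 0 = None -> #|b| = #|K| ->
  exists S : {set {set T * F} * option F}, local_design #|K| b true S.
Proof.
move=> [phi psiK phiK] psi0 /(coordinates 0)[c [c_inj cardc]].
have phiN (g : F) : phi (Some g) != 0.
  by apply/eqP => /(congr1 psi); rewrite phiK psi0.
have psiN z : (psi z != None) = (z != 0) by rewrite -psi0 (can_eq psiK).
pose line (m : K * K) := graph b (fun x => psi (m.1 * c x + m.2)).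
have lineP m x g : reflect (x \in b /\ m.1 * c x + m.2 = phi (Some g))
                           ((x, g) \in line m).
  apply: (iffP (graphP _ _ _ _)) => -[-> e]; split=> //; first by rewrite -e.
  by rewrite e.
exists [set (line m, psi m.1) | m in predC1 (0, 0)]; split.
- move=> _ /imsetP[[m a] ne0 ->] /=; rewrite card_graph /= psiN.
  rewrite (eq_card (B := [set x in b | m * c x + a != 0])); last first.
    by move=> x; rewrite !inE psiN.
  rewrite (cardc [pred z | m * z + a != 0]).
  have [m0|mn0] := eqVneq m 0.
    move: ne0; rewrite m0 !inE xpair_eqE eqxx /= => an0.
    by rewrite addn0; apply: eq_card => z; rewrite !inE mul0r add0r.
  rewrite (cardD1 (- a / m) K) inE addnC; congr (_ + _)%N.
  apply: eq_card => z; rewrite !inE andbT; congr (~~ _).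
  apply/eqP/eqP => [e|->]; last by field.
  by rewrite -[LHS](mulKf mn0) -[m * z](addrK a) e; field.
- by move=> _ /imsetP[m _ ->]; eexists.
- move=> [x g] [y h] /= xb yb nexy.
  have ncxy : c x - c y != 0.
    by rewrite subr_eq0; apply: contra nexy => /eqP/c_inj->.
  pose m := (phi (Some g) - phi (Some h)) / (c x - c y).
  pose a := phi (Some g) - m * c x.
  exists (line (m, a), psi m); split.
    split; last 2 first.
    + by apply/lineP; split=> //=; rewrite /a; ring.
    + by apply/lineP; split=> //=; rewrite /a /m; field.
    apply/imsetP; exists (m, a) => //; rewrite !inE xpair_eqE.
    apply/negP => /andP[/eqP m0]; rewrite /a m0 mul0r subr0 => /eqP e.
    by have := phiN g; rewrite e eqxx.
  move=> _ [/imsetP[[m' a'] _ ->] /= /lineP[_ /= ex] /lineP[_ /= ey]].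
  have em : m = m' by rewrite /m -ex -ey; field.
  have ea : a = a' by rewrite /a -ex em; ring.
  by rewrite em ea.
- move=> [x g] l /= xb; pose m := phi (Some l).
  pose a := phi (Some g) - m * c x.
  exists (line (m, a)); split.
    split; last by apply/lineP; split=> //=; rewrite /a; ring.
    apply/imsetP; exists (m, a); last by rewrite phiK.
    by rewrite !inE xpair_eqE negb_and phiN.
  move=> _ [/imsetP[[m' a'] _ [-> el]] /lineP[_ /= ex]].
  have em : m = m' by rewrite /m el psiK.
  have ea : a = a' by rewrite /a -ex em; ring.
  by rewrite em ea.
Qed.

(** The line of parameters [(m, a)] takes the value [m * t + a] at the finite
    place [t] of the projective line and the value [m] at infinity, so two
    places always determine [(m, a)]. *)
Lemma transversal_local_design (T : finType) (F : finFieldType) (b : {set T}) :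
  #|b| = #|F|.+1 ->
  exists S : {set {set T * F} * option F}, local_design #|F|.+1 b false S.
Proof.
rewrite -card_option => cardb.
have [c [c_inj _]] := coordinates (None : option F) cardb.
pose val (m : F * F) o := if o is Some t then m.1 * t + m.2 else m.1.
pose line m := graph b (fun x => Some (val m (c x))).
have lineP m x g : reflect (x \in b /\ val m (c x) = g) ((x, g) \in line m).
  by apply: (iffP (graphP _ _ _ _)) => [[-> []]|[-> ->]].
exists [set (line m, None) | m : F * F]; split.
- move=> _ /imsetP[m _ ->] /=; rewrite card_graph /= addn0 -cardb.
  by apply: eq_card => x; rewrite inE andbT.
- by move=> _ /imsetP[m _ ->]; eexists.
- move=> [x g] [y h] /= xb yb nexy.
  have ncxy : c x != c y by apply: contra nexy => /eqP/c_inj->.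
  have [m [[ex ey] uniqm]] :
      exists! m, val m (c x) = g /\ val m (c y) = h.
    case: (c x) (c y) ncxy => [s|] [t|] //=.
    + rewrite (inj_eq Some_inj) -subr_eq0 => nst.
      pose m := (g - h) / (s - t).
      exists (m, g - m * s); split=> [|[m' a'] /= [eg eh]].
        by split=> /=; rewrite /m; field.
      have em : m = m' by rewrite /m -eg -eh; field.
      by rewrite em -eg; congr (_, _); ring.
    + move=> _; exists (h, g - h * s); split=> [|[m' a'] /= [eg eh]].
        by split=> //=; ring.
      by rewrite -eg -eh; congr (_, _); ring.
    + move=> _; exists (g, h - g * t); split=> [|[m' a'] /= [eg eh]].
        by split=> //=; ring.
      by rewrite -eh -eg; congr (_, _); ring.
  exists (line m, None); split.
    by split; [apply: imset_f | apply/lineP..].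
  move=> _ [/imsetP[m' _ ->] /= /lineP[_ ex'] /lineP[_ ey']].
  by rewrite (uniqm m').
- by move=> _ /imsetP[m _ ->].
Qed.

End FieldConstructions.

(** * Gluing the fillings *)

(** All that is needed from resolvability: [s] of the parallel classes can be
    singled out and numbered, [kappa] giving the number of the class of a block.
    It is well defined since the classes are pairwise disjoint. *)
Lemma parallel_class_colouring (T : finType) k (B : {set {set T}}) s :
  1 < k -> resolvable_steiner2 k B -> s <= (#|T| - 1) %/ (k - 1) ->
  exists kappa : {set T} -> option 'I_s,
    forall j x, exists! b, [/\ b \in B, kappa b = Some j & x \in b].
Proof.
move=> k_gt1 [_ [P [partP cardP parP]]]; rewrite -cardP subn1 mulnK; last lia.
move=> les; pose cls j := enum_val (widen_ord les j).
have clsP j : cls j \in P by apply: enum_valP.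
pose kappa b := [pick j | b \in cls j].
have kappaP b j : kappa b = Some j <-> b \in cls j.
  rewrite /kappa; split=> [|bj]; first by case: pickP => // j' bj' [<-].
  case: pickP => [j' bj'|/(_ j)]; last by rewrite bj.
  have tiP := partition_trivIset partP; congr Some; apply/val_inj.
  have : cls j' = cls j.
    by rewrite -(def_pblock tiP (clsP j') bj') -(def_pblock tiP (clsP j) bj).
  by move=> /enum_val_inj/(congr1 val).
exists kappa => j x; have [b [[bj xb] uniqb]] := parP _ (clsP j) x.
exists b; split=> [|b' [_ /kappaP b'j xb']]; last exact: uniqb.
split=> //; last exact/kappaP.
by rewrite -(cover_partition partP); apply/bigcupP; exists (cls j).
Qed.

(** The labels of the glued design are [option (J * F)]: [None] for the
    fibres, [Some (j, l)] for the lines of slope [l] above the blocks of the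
    class [j].  Unlabelled blocks add one more [option]. *)
Definition refine_label (J F : Type) (j : option J) (l : option F) :
    option (option (J * F)) :=
  if (j, l) is (Some j', Some l') then Some (Some (j', l')) else None.

(** Pairs in different fibres are covered once because two points of [T] lie in
    one block [b], and two points of [b * F] in one block above [b].  A label
    [(j, l)] covers a point [(x, g)] once because the class [j] has one block
    [b] through [x], and above [b] the label [l] covers [(x, g)] once. *)
Lemma labelled_design_of_local (T J F : finType) k (B : {set {set T}})
    (kappa : {set T} -> option J)
    (loc : {set T} -> {set {set T * F} * option F}) :
  #|F|.+1 = k -> steiner_system 2 k B ->
  (forall j x, exists! b, [/\ b \in B, kappa b = Some j & x \in b]) ->
  (forall b, b \in B -> local_design k b (kappa b) (loc b)) ->
  exists S : {set {set T * F} * option (option (J * F))}, labelled_design k S.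
Proof.
move=> cardF [_ steinerB] kappaP locP.
pose fibre x := [set v : T * F | v.1 == x].
pose tag b (q : {set T * F} * option F) := (q.1, refine_label (kappa b) q.2).
pose S := [set (fibre x, Some None) | x : T]
            :|: \bigcup_(b in B) [set tag b q | q in loc b].
have SP p : p \in S <-> (exists x, p = (fibre x, Some None)) \/
    (exists b q, [/\ b \in B, q \in loc b & p = tag b q]).
  rewrite inE; split=> [/orP[/imsetP[x _ ->]|/bigcupP[b bB /imsetP[q qb ->]]]|].
  - by left; exists x.
  - by right; exists b, q.
  - case=> [[x ->]|[b [q [bB qb ->]]]]; first by rewrite imset_f.
    by apply/orP; right; apply/bigcupP; exists b => //; apply: imset_f.
have fst_mem b q (v : T * F) : b \in B -> q \in loc b -> v \in q.1 -> v.1 \in b.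
  move=> bB qb; have [_ /(_ _ qb)[f ->] _ _] := locP _ bB.
  by case: v => x g /graphP[].
exists S; split.
- move=> p /SP[[x ->]|[b [q [bB qb ->]]]] /=.
    rewrite addn1 -cardF -[#|F|]mul1n -(cards1 x) -cardsT -cardsX.
    by congr _.+1; apply: eq_card => v; rewrite !inE andbT.
  have [sizeb _ _ labb] := locP _ bB; rewrite -(sizeb _ qb); congr (_ + _).
  by case: (kappa b) labb => [j|/(_ _ qb)->] //; case: q.2.
- move=> [x g] [y h] neuv; have [eqxy|nexy] := eqVneq x y.
    exists (fibre x, Some None); split=> [|p [/SP[[x' ->]|[b [q [bB qb ->]]]]]].
    + by split; [apply/SP; left; exists x | rewrite inE | rewrite inE eqxy].
    + by rewrite inE => /eqP /= ->.
    + have [_ /(_ _ qb)[f /= ->] _ _] := locP _ bB.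
      move=> /graphP[_ fx] /graphP[_]; rewrite -eqxy fx => -[gh].
      by case/eqP: neuv; rewrite eqxy gh.
  have [b [[bB subb] uniqb]] : exists! b, b \in B /\ [set x; y] \subset b.
    by apply: steinerB; rewrite cards2 nexy.
  have [xb yb] : x \in b /\ y \in b.
    by move: subb; rewrite subUset !sub1set => /andP.
  have [_ _ /(_ (x, g) (y, h) xb yb nexy)[q [[qb uq vq] uniqq]] _] := locP _ bB.
  exists (tag b q); split=> [|p [/SP[[x' ->]|[b' [q' [b'B qb' ->]]]]]].
  + by split=> //; apply/SP; right; exists b, q.
  + by rewrite !inE => /eqP /= xx' /eqP /= yx'; case/eqP: nexy; rewrite xx'.
  + move=> uq' vq'.
    have xb' := fst_mem _ _ _ b'B qb' uq'.
    have yb' := fst_mem _ _ _ b'B qb' vq'.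
    have eqb : b = b' by apply: uniqb; rewrite subUset !sub1set xb' yb'.
    by rewrite (uniqq q') // {1}eqb.
- move=> [x g] [[j l]|].
    have [b [[bB kb xb] uniqb]] := kappaP j x.
    have [_ _ _] := locP _ bB; rewrite kb => /(_ (x, g) l xb).
    case=> A [[Ab uA] uniqA]; exists A; split=> [|A' [/SP]].
      split=> //; apply/SP; right; exists b, (A, Some l); split=> //.
      by rewrite /tag kb.
    case=> [[x' []]//|[b' [[A2 l2] [b'B qb' [-> /=]]]]].
    case kb': (kappa b') => [j'|] //; case: l2 qb' => // l2 qb' [jj' ll'] uA'.
    have xb' := fst_mem _ _ _ b'B qb' uA'.
    have eqb : b = b' by apply: uniqb; rewrite jj'.
    by apply: uniqA; rewrite eqb ll'.
  exists (fibre x); split=> [|A [/SP]].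
    by split; [apply/SP; left; exists x | rewrite inE].
  case=> [[x' [->]]|[b [q [_ _ [_]]]]]; first by rewrite inE => /eqP /= ->.
  by case: (kappa b) => [j|]; case: q.2.
Qed.

(** * The mixed Steiner systems *)

Theorem theorem10 (k n : nat) :
  3 <= k -> prime_power k -> prime_power (k - 1) ->
  (exists B : {set {set 'I_n}}, resolvable_steiner2 k B) ->
  forall i : nat, i <= (n - 1) %/ (k - 1) ->
  exists C : {set word (rcons (nseq ((k - 1) * n) 2) (n + 1 - (k - 1) * i))},
    mixed_steiner 2 k C.
Proof.
move=> k_ge3 [p [e [p_pr e_gt0 k_pe]]] [p' [e' [p'_pr e'_gt0 k1_pe]]].
move=> [B resB] i le_i.
have [K _] := pPrimePowerField p_pr e_gt0; rewrite -k_pe => cardK.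
have [F _] := pPrimePowerField p'_pr e'_gt0; rewrite -k1_pe => cardF.
have cardF1 : #|F|.+1 = k by rewrite cardF; lia.
have [steinerB [P [_ cardP _]]] := resB; rewrite card_ord in cardP.
have rE : (n - 1) %/ (k - 1) = #|P|.
  by rewrite (_ : n - 1 = #|P| * (k - 1)) ?mulnK //; lia.
(* Labelling all but [i] classes gives [1 + s (k - 1) = n - (k - 1) i] labels,
   the number of nonzero letters of the last alphabet. *)
set s := #|P| - i.
have [||kappa kappaP] := @parallel_class_colouring _ _ _ s _ resB.
- by lia.
- by rewrite card_ord rE leq_subr.
have [|psi psi_bij psi0] := @pointed_bijection K (option F) 0%R None.
  by rewrite card_option cardF1.
have locP b : exists S : {set {set 'I_n * F} * option F},
    b \in B -> local_design k b (kappa b) S.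
  case: (boolP (b \in B)) => [bB|_]; last by exists set0.
  have cardb := steinerB.1 b bB.
  case: (kappa b) => [j|].
    have [|S SP] := affine_local_design psi_bij psi0 (b := b).
      by rewrite cardb.
    by exists S; rewrite -cardK.
  have [|S SP] := @transversal_local_design _ F b; first by rewrite cardb.
  by exists S; rewrite -cardF1.
have [loc {}locP] := fin_all_exists locP.
have [S SP] := labelled_design_of_local cardF1 steinerB kappaP locP.
apply: (mixed_steiner_of_design _ _ _ k_ge3 SP).
- by rewrite card_prod card_ord cardF mulnC.
- rewrite card_option card_prod card_ord cardF /s.
  by rewrite mulnBl; move: le_i cardP; rewrite rE; nia.
- by move: le_i; rewrite rE => le_i; nia.
Qed.
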